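(* Let $E:=\mathbb{R}^{\mathbb{N}}$ with the product topology, regarded as a real topological vector space, and let all tensor products be formed in the class of all real topological vector spaces. Then the following holds: (a) The canonical isomorphism of vector spaces $$\theta: (E\otimes E)\otimes E\to E\otimes (E\otimes E),\qquad \theta((x\otimes y)\otimes z)=x\otimes(y\otimes z),$$ is not continuous (and hence not an isomorphism of topological vector spaces). (b) The canonical isomorphisms of vector spaces $$\phi: E\otimes E\otimes E\to (E\otimes E)\otimes E,\qquad \phi(x\otimes y\otimes z)=(x\otimes y)\otimes z,$$ and $$\psi: E\otimes E\otimes E\to E\otimes (E\otimes E),\qquad \psi(x\otimes y\otimes z)=x\otimes (y\otimes z),$$ are continuous but not open.
   Context: $\mathbb{N}=\{1,2,\ldots\}$. Topological vector spaces are not presumed Hausdorff or locally convex. Given real topological vector spaces $E_1,\ldots,E_n$ ($n\ge 2$), a tensor product of $E_1,\ldots,E_n$ in the class of real topological vector spaces is a real topological vector space $T$ together with a continuous $n$-linear map $\tau:E_1\times\cdots\times E_n\to T$ such that for every real topological vector space $F$ and every continuous $n$-linear map $f:E_1\times\cdots\times E_n\to F$ there is a unique continuous linear map $\widetilde f:T\to F$ with $\widetilde f\circ\tau=f$. It is realized as follows, and is denoted $E_1\otimes\cdots\otimes E_n$: the underlying vector space is the algebraic tensor product $T=E_1\otimes_{\mathbb{R}}\cdots\otimes_{\mathbb{R}}E_n$ with $\tau(x_1,\ldots,x_n)=x_1\otimes\cdots\otimes x_n$, and a basis of zero-neighbourhoods for its vector topology is given by the sets $$\bigcup_{k\in\mathbb{N}}\sum_{\ell=1}^{k}\tau(U_{\ell,1}\times\cdots\times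 U_{\ell,n}),$$ where, for each $j=1,\ldots,n$, $(U_{k,j})_{k\in\mathbb{N}}$ is a sequence of balanced zero-neighbourhoods in $E_j$ (sums of sets are Minkowski sums). $E\otimes E\otimes E$ denotes the three-fold tensor product in this sense (for $n=3$), while $(E\otimes E)\otimes E$ and $E\otimes(E\otimes E)$ are iterated two-fold tensor products, where the inner $E\otimes E$ carries its tensor product topology. The maps $\theta,\phi,\psi$ are the linear maps determined by the indicated values on elementary tensors; they are the usual algebraic isomorphisms of vector spaces. *)

(* Defs.v *)
From HB Require Import structures.
From mathcomp Require Import all_boot all_order all_algebra.
From mathcomp Require Import generic_quotient ring_quotient.
From mathcomp Require Import monalg.
From mathcomp Require Import all_classical all_reals all_analysis.

Set Implicit Arguments.
Unset Strict Implicit.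
Unset Printing Implicit Defensive.

Import Order.TTheory GRing.Theory Num.Theory.
Import numFieldTopology.Exports.

Local Open Scope classical_set_scope.
Local Open Scope ring_scope.
Local Open Scope quotient_scope.

Definition balanced {R : realType} {V : lmodType R} (A : set V) : Prop :=
  forall (a : R) v, `|a| <= 1 -> A v -> A (a *: v).

(* A real topological vector space is a topologicalLmodType R: the addition and
   the scaling are jointly continuous, and neither separation nor local
   convexity is assumed. The family E has n + 2 members, so that it has at
   least two. *)
Section TensorSpace.
Context {R : realType} {n : nat}.
Variable E : 'I_n.+2 -> topologicalLmodType R.

Definition tuples : Type := forall i, E i.
HB.instance Definition _ := Choice.on tuples.

Let upd (x : tuples) (i : 'I_n.+2) (u : E i) : tuples := dfwith x i u.

(* The algebraic tensor product is the free vector space on the tuples modulo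
   the subspace spanned by the relators that make << x >> linear in each
   coordinate of x. *)
Definition tensor_relators : set {malg R[tuples]} :=
  [set r | exists (i : 'I_n.+2) (x : tuples) (a : R) (u v : E i),
     r = << upd x (a *: u + v) >> - (a *: << upd x u >> + << upd x v >>)].

Definition subspace_closed (M : set {malg R[tuples]}) : Prop :=
  M 0 /\ forall (a : R) r s, M r -> M s -> M (a *: r + s).

Definition tensor_ker : {pred {malg R[tuples]}} :=
  [pred r | `[< smallest subspace_closed tensor_relators r >] ].

Lemma tensor_kerP r :
  reflect (smallest subspace_closed tensor_relators r) (r \in tensor_ker).
Proof. exact: asboolP. Qed.

Lemma tensor_ker_submod : submod_closed tensor_ker.
Proof.
split; first by apply/tensor_kerP => M [[M0 _] _].
move=> a r s /tensor_kerP kr /tensor_kerP ks.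
by apply/tensor_kerP => M MP; apply: MP.1.2; [exact: kr|exact: ks].
Qed.

Lemma tensor_ker_zmod : zmod_closed tensor_ker.
Proof.
have [k0 kD] := tensor_ker_submod; split=> // r s kr ks.
by rewrite addrC -scaleN1r; exact: kD.
Qed.

HB.instance Definition _ :=
  GRing.isZmodClosed.Build {malg R[tuples]} tensor_ker tensor_ker_zmod.

Definition tensor : Type := Quotient.quot tensor_ker.

HB.instance Definition _ := EqQuotient.on tensor.
HB.instance Definition _ := GRing.Zmodule.on tensor.

Definition to_tensor (r : {malg R[tuples]}) : tensor := \pi_tensor r.

Lemma to_tensor_repr t : to_tensor (repr t) = t.
Proof. exact: reprK. Qed.

Lemma to_tensorD : {morph to_tensor : r s / r + s}.
Proof. exact: (@pi_addr _ _ _ _ _ (Quotient.quot tensor_ker)). Qed.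

Lemma to_tensor_eq r s : to_tensor r = to_tensor s <-> r - s \in tensor_ker.
Proof.
have e : (r - s \in tensor_ker) = (to_tensor r == to_tensor s).
  exact: Quotient.idealrBE.
by rewrite e; split=> /eqP.
Qed.

Definition tensor_scale (a : R) (t : tensor) : tensor := to_tensor (a *: repr t).

Lemma tensor_scale_pi a r : tensor_scale a (to_tensor r) = to_tensor (a *: r).
Proof.
apply/to_tensor_eq; rewrite -scalerBr -[_ *: _]addr0.
by apply: tensor_ker_submod.2; [exact/to_tensor_eq/to_tensor_repr|
  exact: tensor_ker_submod.1].
Qed.

Lemma tensor_scaleA a b t :
  tensor_scale a (tensor_scale b t) = tensor_scale (a * b) t.
Proof. by rewrite tensor_scale_pi scalerA. Qed.

Lemma tensor_scale1 : left_id 1 tensor_scale.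
Proof. by move=> t; rewrite /tensor_scale scale1r to_tensor_repr. Qed.

Lemma tensor_scaleDr : right_distributive tensor_scale +%R.
Proof.
move=> a t u; rewrite -[t]to_tensor_repr -[u]to_tensor_repr -to_tensorD.
by rewrite !tensor_scale_pi scalerDr to_tensorD.
Qed.

Lemma tensor_scaleDl t : {morph tensor_scale^~ t : a b / a + b}.
Proof. by move=> a b; rewrite /tensor_scale scalerDl to_tensorD. Qed.

HB.instance Definition _ := GRing.Zmodule_isLmodule.Build R tensor
  tensor_scaleA tensor_scale1 tensor_scaleDr tensor_scaleDl.

Lemma to_tensorZ a r : to_tensor (a *: r) = a *: to_tensor r.
Proof. by rewrite -tensor_scale_pi. Qed.

Definition pure_tensor (x : tuples) : tensor := to_tensor << x >>.

Lemma pure_tensor_linear (x : tuples) i :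
  linear (fun u : E i => pure_tensor (upd x u)).
Proof.
move=> a u v; rewrite -to_tensorZ -to_tensorD; apply/to_tensor_eq.
by apply/tensor_kerP => M [_]; apply; exists i, x, a, u, v.
Qed.

Lemma pure_tensorZ x i a (u : E i) :
  pure_tensor (upd x (a *: u)) = a *: pure_tensor (upd x u).
Proof.
have lin := @pure_tensor_linear x i.
have p0 : pure_tensor (upd x (0 : E i)) = 0.
  have /eqP := lin 1 0 0; rewrite !scale1r addr0.
  by rewrite -[X in X == _]addr0 (inj_eq (addrI _)) => /eqP.
by have := lin a u 0; rewrite addr0 p0 addr0.
Qed.

Lemma upd_id (x : tuples) i : upd x (x i) = x.
Proof. by apply: functional_extensionality_dep => j; rewrite /upd; case: dfwithP. Qed.

Lemma pure_tensor_scale_all x a :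
  pure_tensor (fun j => a *: x j) = a ^+ n.+2 *: pure_tensor x.
Proof.
pose y k : tuples := fun j => if (j < k)%N then a *: x j else x j.
have yE k : (k <= n.+2)%N -> pure_tensor (y k) = a ^+ k *: pure_tensor x.
  elim: k => [_|k IHk kn]; first by rewrite expr0 scale1r; congr pure_tensor.
  pose i := Ordinal kn.
  have -> : y k.+1 = upd (y k) (a *: y k i).
    apply: functional_extensionality_dep => j; rewrite /upd.
    case: dfwithP => [|{}j ij]; first by rewrite /y /= ltnS leqnn ltnn.
    rewrite /y ltnS leq_eqVlt; case: eqVneq => //= jk.
    by move: ij; rewrite -val_eqE /= jk eqxx.
  by rewrite pure_tensorZ upd_id IHk ?(ltnW kn)// scalerA -exprS.
rewrite -yE//; congr pure_tensor; apply: functional_extensionality_dep => j.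
by rewrite /y ltn_ord.
Qed.

Lemma tensor_span t : exists s : seq tuples, t = \sum_(x <- s) pure_tensor x.
Proof.
pose P t := exists s : seq tuples, t = \sum_(x <- s) pure_tensor x.
have P0 : P 0 by exists [::]; rewrite big_nil.
have PD u v : P u -> P v -> P (u + v).
  by move=> [s ->] [s' ->]; exists (s ++ s'); rewrite big_cat.
have Pp a x : P (a *: pure_tensor x).
  exists [:: upd x (a *: x ord0)]; rewrite big_seq1.
  by rewrite pure_tensorZ upd_id.
have to0 : to_tensor 0 = 0.
  by rewrite -(scale0r (0 : {malg R[tuples]})) to_tensorZ scale0r.
suff : forall r, P (to_tensor r) by move=> /(_ (repr t)); rewrite to_tensor_repr.
move=> r; rewrite [r]monalgE; elim: (finmap.enum_fset (msupp r)) => [|x s IH].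
  by rewrite big_nil to0.
rewrite big_cons to_tensorD; apply: PD => //.
suff -> : << r@_x *g x >> = r@_x *: << x >> :> {malg R[tuples]}.
  by rewrite to_tensorZ; exact: Pp.
by apply/malgP => k; rewrite mcoeffZ !mcoeffU mulr_natr.
Qed.

Definition balanced_nbhs0_seqs (U : forall j, nat -> set (E j)) : Prop :=
  forall j l, balanced (U j l) /\ nbhs 0 (U j l).

(* The union over k of the Minkowski sums, for l = 0, ..., k, of the images under
   pure_tensor of the products of the U j l over j. A sequence of
   zero-neighbourhoods is indexed from 0, so the k-th sum has k + 1 terms. *)
Definition tensor_basic_nbhs0 (U : forall j, nat -> set (E j)) : set tensor :=
  \bigcup_k [set \sum_(l < k.+1) pure_tensor (x l)
            | x in [set x : 'I_k.+1 -> tuples |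
              forall (l : 'I_k.+1) j, U j l (x l j)]].

Definition tensor_nbhs (t : tensor) : set_system tensor :=
  [set A | exists2 U, balanced_nbhs0_seqs U
         & forall u, tensor_basic_nbhs0 U u -> A (t + u)].

Lemma balanced_nbhs00 U j l : balanced_nbhs0_seqs U -> U j l 0.
Proof. by move=> /(_ j l)[_]; exact: nbhs_singleton. Qed.

Lemma pure_tensor0 : pure_tensor (fun=> 0) = 0.
Proof.
have := pure_tensor_scale_all (fun=> 0) 0; rewrite exprS mul0r scale0r => <-.
by congr pure_tensor; apply: functional_extensionality_dep => j; rewrite scaler0.
Qed.

Lemma tensor_basic_nbhs0_intro U (x : nat -> tuples) k :
  balanced_nbhs0_seqs U -> (forall l j, U j l (x l j)) ->
  tensor_basic_nbhs0 U (\sum_(l < k) pure_tensor (x l)).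
Proof.
move=> Ub Ux; case: k => [|k].
  rewrite big_ord0; exists 0%N => //; exists (fun _ _ => 0).
    by move=> l j; exact: balanced_nbhs00.
  by rewrite big_ord1 pure_tensor0.
by exists k => //; exists (fun l => x l).
Qed.

Lemma tensor_basic_nbhs0_elim U t :
  balanced_nbhs0_seqs U -> tensor_basic_nbhs0 U t ->
  exists2 x : nat -> tuples, (forall l j, U j l (x l j)) &
    exists k, forall m, (k <= m)%N -> t = \sum_(l < m) pure_tensor (x l).
Proof.
move=> Ub [k _ [x Ux <-]].
exists (fun l => if insub l is Some i then x i else (fun=> 0)).
  move=> l j; case: insubP => [i _ <-|_]; first exact: Ux.
  exact: balanced_nbhs00.
exists k.+1 => m km; rewrite -(subnKC km) big_split_ord /=.
rewrite [X in _ + X]big1 ?addr0.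
  by apply: eq_bigr => i _; rewrite valK.
by move=> i _; rewrite insubN ?pure_tensor0// -leqNgt leq_addr.
Qed.

Lemma tensor_basic_nbhs0_add U : balanced_nbhs0_seqs U ->
  exists2 V, balanced_nbhs0_seqs V &
    forall u v, tensor_basic_nbhs0 V u -> tensor_basic_nbhs0 V v ->
      tensor_basic_nbhs0 U (u + v).
Proof.
move=> Ub; pose V j l := U j l.*2 `&` U j l.*2.+1.
have Vb : balanced_nbhs0_seqs V.
  move=> j l; split; last by apply: filterI; exact: (Ub _ _).2.
  by move=> a v a1 [v1 v2]; split; apply: (Ub _ _).1.
exists V => // u v /(tensor_basic_nbhs0_elim Vb)[x Vx [k xE]].
move=> /(tensor_basic_nbhs0_elim Vb)[y Vy [k' yE]].
pose N := maxn k k'; pose z l := if odd l then y l./2 else x l./2.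
have -> : u + v = \sum_(l < N.*2) pure_tensor (z l).
  rewrite (xE N) ?leq_maxl// (yE N) ?leq_maxr//.
  elim: N => [|N IHN]; first by rewrite !big_ord0 addr0.
  rewrite doubleS !big_ord_recr /= -IHN addrACA -!addrA.
  by rewrite /z /= !odd_double /= doubleK uphalf_double.
apply: tensor_basic_nbhs0_intro => // l j; rewrite /z.
have := odd_double_half l; case: odd => /= lE.
  by rewrite -[in U j l]lE; exact: (Vy _ _).2.
by rewrite -[in U j l]lE; exact: (Vx _ _).1.
Qed.

Lemma tensor_basic_nbhs0_balanced U : balanced_nbhs0_seqs U ->
  balanced (tensor_basic_nbhs0 U).
Proof.
move=> Ub a _ a1 [k _ [x Ux <-]]; exists k => //.
exists (fun l => upd (x l) (a *: x l ord0)).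
  move=> l j; rewrite /upd; case: dfwithP => // {j}.
  exact: (Ub _ _).1.
by rewrite scaler_sumr; apply: eq_bigr => l _; rewrite pure_tensorZ upd_id.
Qed.

Lemma tensor_basic_nbhs0_scale U (b : R) : balanced_nbhs0_seqs U ->
  exists2 V, balanced_nbhs0_seqs V &
    forall a v, `|a| <= b -> tensor_basic_nbhs0 V v ->
      tensor_basic_nbhs0 U (a *: v).
Proof.
move=> Ub.
have [m bm] : exists m : nat, b <= 2 ^+ m.
  exists (Num.truncn b).+1; apply: ltW; apply: (lt_le_trans (truncnS_gt b)).
  by rewrite -natrX ler_nat ltnW// ltn_expl.
suff [V Vb VU] : exists2 V, balanced_nbhs0_seqs V &
    forall v, tensor_basic_nbhs0 V v -> tensor_basic_nbhs0 U (2 ^+ m *: v).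
  exists V => // a v ab Vv.
  have m0 : 2 ^+ m != 0 :> R by rewrite expf_neq0.
  rewrite -[a](divfK m0) -scalerA.
  apply: tensor_basic_nbhs0_balanced; [by []| |exact: VU].
  rewrite normrM normfV (ger0_norm (exprn_ge0 _ _))//.
  by rewrite ler_pdivrMr ?exprn_gt0// mul1r (le_trans ab).
elim: m {bm} => [|m [V Vb VU]].
  by exists U => // v; rewrite expr0 scale1r.
have [W Wb WV] := tensor_basic_nbhs0_add Vb.
exists W => // v Wv; rewrite exprSr -scalerA; apply: VU.
by rewrite scaler_nat mulr2n; exact: WV.
Qed.

Lemma tensor_basic_nbhs0_absorb U t : balanced_nbhs0_seqs U ->
  exists2 e : R, 0 < e &
    forall a, `|a| <= e -> tensor_basic_nbhs0 U (a *: t).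
Proof.
move=> Ub; have [s ->] := tensor_span t.
elim: s U Ub => [|x s IHs] U Ub.
  exists 1 => // a _; rewrite big_nil scaler0.
  have := @tensor_basic_nbhs0_intro U (fun _ _ => 0) 0 Ub.
  by rewrite big_ord0; apply => l j; exact: balanced_nbhs00.
have [V Vb VU] := tensor_basic_nbhs0_add Ub.
have [e e0 eV] := IHs V Vb.
suff [d d0 dV] : exists2 d : R, 0 < d &
    forall a, `|a| <= d -> tensor_basic_nbhs0 V (a *: pure_tensor x).
  exists (Num.min d e); first by rewrite lt_min d0.
  move=> a; rewrite le_min => /andP[ad ae].
  by rewrite big_cons scalerDr; apply: VU; [exact: dV|exact: eV].
have [d d0 dV] : exists2 d : R, 0 < d & forall j, V j 0%N (d *: x j).
  have : nbhs (0 : R^o) [set d | forall j, V j 0%N (d *: x j)].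
    apply: (@filter_forall R^o 'I_n.+2 (fun j => [set d | V j 0%N (d *: x j)])
      (nbhs (0 : R^o)) (nbhs_filter _)) => j.
    have := @scale_continuous R (E j) (0, x j) (V j 0%N).
    rewrite /= scale0r => /(_ (Vb _ _).2) [[/= A B] [A0 Bx] ABV].
    apply: filterS A0 => d Ad; apply: (ABV (d, x j)).
    by split=> //=; exact: nbhs_singleton.
  move=> /nbhs_ballP[d /= d0 dV]; exists (d / 2); first by rewrite divr_gt0.
  apply: dV; rewrite /ball /= sub0r normrN gtr0_norm ?divr_gt0//.
  by rewrite ltr_pdivrMr// ltr_pMr// ltr1n.
exists (d ^+ n.+2); first exact: exprn_gt0.
move=> a ad.
have dn0 : d ^+ n.+2 != 0 by rewrite expf_neq0// gt_eqF.
rewrite -[a](divfK dn0) -scalerA -pure_tensor_scale_all.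
apply: tensor_basic_nbhs0_balanced => //.
  rewrite normrM normfV (gtr0_norm (exprn_gt0 _ _))//.
  by rewrite ler_pdivrMr ?exprn_gt0// mul1r.
exists 0%N => //; exists (fun _ j => d *: x j); last by rewrite big_ord1.
by move=> l j; rewrite ord1; exact: dV.
Qed.

Lemma tensor_nbhs_filter t : ProperFilter (tensor_nbhs t).
Proof.
split.
  move=> [U Ub /(_ 0)]; apply.
  have := @tensor_basic_nbhs0_intro U (fun _ _ => 0) 0 Ub.
  by rewrite big_ord0; apply => l j; exact: balanced_nbhs00.
split.
- exists (fun _ _ => setT) => // j l; split=> //; exact: filterT.
- move=> A B [U Ub UA] [V Vb VB]; exists (fun j l => U j l `&` V j l).
    move=> j l; split; last by apply: filterI; [exact: (Ub _ _).2|exact: (Vb _ _).2].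
    by move=> a v a1 [Uv Vv]; split; [exact: (Ub _ _).1|exact: (Vb _ _).1].
  move=> _ [k _ [x UVx <-]]; split.
    by apply: UA; exists k => //; exists x => // l j; exact: (UVx _ _).1.
  by apply: VB; exists k => //; exists x => // l j; exact: (UVx _ _).2.
- by move=> A B AB [U Ub UA]; exists U => // u /UA /AB.
Qed.

Lemma tensor_nbhs_singleton t A : tensor_nbhs t A -> A t.
Proof.
move=> [U Ub /(_ 0)]; rewrite addr0; apply.
have := @tensor_basic_nbhs0_intro U (fun _ _ => 0) 0 Ub.
by rewrite big_ord0; apply => l j; exact: balanced_nbhs00.
Qed.

Lemma tensor_nbhs_nbhs t A : tensor_nbhs t A -> tensor_nbhs t (tensor_nbhs^~ A).
Proof.
move=> [U Ub UA]; have [V Vb VU] := tensor_basic_nbhs0_add Ub.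
exists V => // u Vu; exists V => // v Vv.
by rewrite -addrA; apply: UA; exact: VU.
Qed.

HB.instance Definition _ := hasNbhs.Build tensor tensor_nbhs.
HB.instance Definition _ := Nbhs_isNbhsTopological.Build tensor
  tensor_nbhs_filter tensor_nbhs_singleton tensor_nbhs_nbhs.

Lemma tensor_nbhs0P (A : set tensor) : nbhs (0 : tensor) A <->
  exists2 U, balanced_nbhs0_seqs U & tensor_basic_nbhs0 U `<=` A.
Proof.
by split=> -[U Ub UA]; exists U => // u /UA; rewrite add0r.
Qed.

Lemma tensor_add_continuous : continuous (fun z : tensor * tensor => z.1 + z.2).
Proof.
move=> [t t'] A /= [U Ub UA]; have [V Vb VU] := tensor_basic_nbhs0_add Ub.
pose B s : set tensor := [set s + v | v in tensor_basic_nbhs0 V].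
have BV s : nbhs s (B s) by exists V => // u Vu; exists u.
exists (B t, B t'); first by split; exact: BV.
move=> [_ _] /= [[v Vv <-] [v' Vv' <-]]; rewrite addrACA.
by apply: UA; exact: VU.
Qed.

Lemma tensor_scale_continuous :
  continuous (fun z : R^o * tensor => z.1 *: z.2).
Proof.
move=> [r t] A /= [U Ub UA]; have [V Vb VU] := tensor_basic_nbhs0_add Ub.
have [W Wb WV] := tensor_basic_nbhs0_scale (`|r| + 1) Vb.
have [e e0 eV] := tensor_basic_nbhs0_absorb t Vb.
exists (ball (r : R^o) (Num.min e 1), [set t + w | w in tensor_basic_nbhs0 W]).
  split; first by apply: nbhsx_ballx; rewrite lt_min e0 ltr01.
  by exists W => // u Wu; exists u.
move=> [a _] /= [ra [w Ww <-]].
move: ra; rewrite /ball /= distrC lt_min => /andP[rae ra1].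
rewrite scalerDr -[a in a *: t](subrK r) scalerDl [_ + r *: t]addrC -addrA.
apply: UA; apply: VU; first by apply: eV; exact: ltW.
apply: WV => //; rewrite -[a](subrK r) addrC (le_trans (ler_normD _ _))//.
by rewrite lerD2l ltW.
Qed.

HB.instance Definition _ := PreTopologicalNmodule_isTopologicalNmodule.Build
  tensor tensor_add_continuous.
HB.instance Definition _ := TopologicalNmodule_isTopologicalLmodule.Build
  R tensor tensor_scale_continuous.

End TensorSpace.

Definition family2 {R : realType} (A B : topologicalLmodType R) (i : 'I_2) :
    topologicalLmodType R :=
  match val i with 0%N => A | _ => B end.

Definition tensor2 {R : realType} (A B : topologicalLmodType R) :
    topologicalLmodType R :=
  tensor (family2 A B).

Definition pure2 {R : realType} {A B : topologicalLmodType R} (a : A) (b : B) :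
    tensor2 A B :=
  @pure_tensor R 0 (family2 A B) (fun i =>
    match val i as k
      return (match k with 0%N => A | _ => B end : topologicalLmodType R)
    with 0%N => a | _ => b end).

Definition family3 {R : realType} (A B C : topologicalLmodType R) (i : 'I_3) :
    topologicalLmodType R :=
  match val i with 0%N => A | 1%N => B | _ => C end.

Definition tensor3 {R : realType} (A B C : topologicalLmodType R) :
    topologicalLmodType R :=
  tensor (family3 A B C).

Definition pure3 {R : realType} {A B C : topologicalLmodType R}
    (a : A) (b : B) (c : C) : tensor3 A B C :=
  @pure_tensor R 1 (family3 A B C) (fun i =>
    match val i as k
      return (match k with 0%N => A | 1%N => B | _ => C end
              : topologicalLmodType R)
    with 0%N => a | 1%N => b | _ => c end).

Section RealSequences.
Variable R : realType.

(* R^o is R as a module over itself; the product topology is the one of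
   pointwise convergence. *)
Definition real_seq : Type := {ptws nat -> R^o}.

HB.instance Definition _ := Topological.on real_seq.
HB.instance Definition _ := GRing.Lmodule.copy real_seq (nat -> R^o).

Lemma real_seq_proj_continuous k : continuous (fun x : real_seq => x k).
Proof. exact: (@proj_continuous nat (fun=> R^o) k). Qed.

Lemma real_seq_continuous (T : topologicalType) (f : T -> real_seq) :
  (forall k, continuous (fun t => f t k : R^o)) -> continuous f.
Proof.
move=> fk t; apply/cvg_sup => k.
apply: (@continuous_comp_initial (nat -> R^o) T R^o (fun x => x k) f).
exact: fk.
Qed.

Lemma real_seq_add_continuous :
  continuous (fun z : real_seq * real_seq => z.1 + z.2).
Proof.
apply: real_seq_continuous => k [x y].
have p1 : {for (x, y), continuous (fun z : real_seq * real_seq => z.1 k : R^o)}.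
  apply: (@continuous_comp _ _ _ fst (fun w : real_seq => w k : R^o)).
    exact: cvg_fst.
  exact: real_seq_proj_continuous.
have p2 : {for (x, y), continuous (fun z : real_seq * real_seq => z.2 k : R^o)}.
  apply: (@continuous_comp _ _ _ snd (fun w : real_seq => w k : R^o)).
    exact: cvg_snd.
  exact: real_seq_proj_continuous.
exact: (@cvg_comp _ _ _ _ _ _ _ _ (cvg_pair p1 p2)
  (@add_continuous R^o (x k, y k))).
Qed.

Lemma real_seq_scale_continuous :
  continuous (fun z : R^o * real_seq => z.1 *: z.2).
Proof.
apply: real_seq_continuous => k [a x].
have p1 : {for (a, x), continuous (fun z : R^o * real_seq => z.1)}.
  exact: cvg_fst.
have p2 : {for (a, x), continuous (fun z : R^o * real_seq => z.2 k : R^o)}.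
  apply: (@continuous_comp _ _ _ snd (fun w : real_seq => w k : R^o)).
    exact: cvg_snd.
  exact: real_seq_proj_continuous.
exact: (@cvg_comp _ _ _ _ _ _ _ _ (cvg_pair p1 p2)
  (@scale_continuous R R^o (a, x k))).
Qed.

HB.instance Definition _ := PreTopologicalNmodule_isTopologicalNmodule.Build
  real_seq real_seq_add_continuous.
HB.instance Definition _ := TopologicalNmodule_isTopologicalLmodule.Build
  R real_seq real_seq_scale_continuous.

End RealSequences.

Definition open_map {S T : topologicalType} (f : S -> T) : Prop :=
  forall U : set S, open U -> open (f @` U).

(* The inverse g is automatically linear. *)
Definition tvs_isomorphism {R : realType} {S T : topologicalLmodType R}
    (f : {linear S -> T}) : Prop :=
  exists2 g : T -> S, cancel f g /\ cancel g f & continuous f /\ continuous g.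

(* These equations determine the linear maps, since elementary tensors span
   (tensor_span). *)
Section CanonicalMaps.
Context {R : realType} {A B C : topologicalLmodType R}.

Definition is_theta
    (f : {linear tensor2 (tensor2 A B) C -> tensor2 A (tensor2 B C)}) : Prop :=
  forall x y z, f (pure2 (pure2 x y) z) = pure2 x (pure2 y z).

Definition is_phi
    (f : {linear tensor3 A B C -> tensor2 (tensor2 A B) C}) : Prop :=
  forall x y z, f (pure3 x y z) = pure2 (pure2 x y) z.

Definition is_psi
    (f : {linear tensor3 A B C -> tensor2 A (tensor2 B C)}) : Prop :=
  forall x y z, f (pure3 x y z) = pure2 x (pure2 y z).

End CanonicalMaps.

(* Main.v *)
Require Import Defs.
From HB Require Import structures.
From mathcomp Require Import all_boot all_order all_algebra.
From mathcomp Require Import finmap monalg.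
From mathcomp Require Import ring.
From mathcomp Require Import all_classical all_reals all_analysis.

(* Every zero-neighbourhood of E contains a line R e_m, so if theta were
   continuous, then for every zero-neighbourhood N of E (x) (E (x) E) the image
   under theta of (m + 2) sum_(i <= m) (e_i (x) e_i) (x) e_m would lie in N for
   some m.
   Take for N the sums of elements of U_l (x) V_l, where U_l bounds the first
   l + 1 coordinates by 2^-(l+1), and V_l the coefficients of index at most l.
   Reading the third coordinate at m turns an element of N into a matrix: the
   terms l < m contribute rank at most m, while on the (m + 1) x (m + 1) corner
   the entries contributed by the terms l >= m are bounded by 1 in total. Such a
   matrix cannot be (m + 2) times the identity. The same computation in
   E (x) E (x) E shows that psi is not open, and phi is not open because
   theta = psi o phi^-1 with psi continuous. *)

Set Implicit Arguments.
Unset Strict Implicit.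
Unset Printing Implicit Defensive.

Import Order.TTheory GRing.Theory Num.Theory.
Import numFieldTopology.Exports.

Local Open Scope classical_set_scope.
Local Open Scope ring_scope.

(** * Universal property of the algebraic tensor product *)

Section MalgLift.
Context {R : realType} {K : choiceType} {L : lmodType R}.
Variable g : K -> L.

Definition malg_lift (r : {malg R[K]}) : L := \sum_(k <- msupp r) r@_k *: g k.

(** Linearity compares sums over three different supports; they become comparable on a common finite
    set, where the extra coefficients vanish. *)
Lemma malg_liftEw (d : {fset K}) r : (msupp r `<=` d)%fset ->
  malg_lift r = \sum_(k <- d) r@_k *: g k.
Proof.
move=> rd; apply: big_fset_incl => // k _ kr.
by rewrite mcoeff_outdom// scale0r.
Qed.

Lemma malg_liftU k : malg_lift << k >> = g k.
Proof.
by rewrite (malg_liftEw msuppU_le) big_seq_fset1 mcoeffUU scale1r.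
Qed.

Lemma malg_lift_linear : linear malg_lift.
Proof.
move=> a r s; pose d := (msupp r `|` msupp s)%fset.
have rd : (msupp r `<=` d)%fset by exact: fsubsetUl.
have sd : (msupp s `<=` d)%fset by exact: fsubsetUr.
have ard : (msupp (a *: r + s) `<=` d)%fset.
  apply: fsubset_trans (msuppD_le _ _) _; rewrite fsubUset sd andbT.
  exact: fsubset_trans (msuppZ_le _ _) rd.
rewrite (malg_liftEw rd) (malg_liftEw sd) (malg_liftEw ard).
rewrite scaler_sumr -big_split; apply: eq_bigr => k _ /=.
by rewrite mcoeffD mcoeffZ scalerDl scalerA.
Qed.
HB.instance Definition _ := GRing.isLinear.Build _ _ _ _ malg_lift
  malg_lift_linear.

End MalgLift.

Section TensorLift.
Context {R : realType} {n : nat}.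
Context {E : 'I_n.+2 -> topologicalLmodType R}.

Definition multilinear {L : lmodType R} (g : tuples E -> L) : Prop :=
  forall (x : tuples E) i, linear (fun u : E i => g (dfwith x i u)).

Lemma tensor_linear_ext (L : lmodType R) (f h : {linear tensor E -> L}) :
  (forall x, f (pure_tensor x) = h (pure_tensor x)) -> f =1 h.
Proof.
move=> fh t; have [s ->] := tensor_span t.
by rewrite !linear_sum; apply: eq_bigr => x _; exact: fh.
Qed.

(** The kernel of the linear extension of [g] is a subspace, and by multilinearity it contains every
    relator, hence all of [tensor_ker]; the extension therefore descends to the quotient. *)
Lemma tensor_lift_ex {L : lmodType R} {g : tuples E -> L} :
  multilinear g -> {f : {linear tensor E -> L} | forall x, f (pure_tensor x) = g x}.
Proof.
move=> glin.
have ker r : r \in tensor_ker (E:=E) -> malg_lift g r = 0.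
  move=> /tensor_kerP kr; apply: (kr [set r | malg_lift g r = 0]); split.
    split=> /=; first by rewrite linear0.
    by move=> a r' s /= r0 s0; rewrite linearD linearZ /= r0 s0 scaler0 addr0.
  move=> _ [i [x [a [u [v ->]]]]] /=.
  rewrite linearB linearD linearZ /= !malg_liftU.
  by have /= -> := glin x i a u v; rewrite subrr.
(* The value is taken at a chosen representative; [ker] makes it independent of the choice. *)
pose f (t : tensor E) : L := malg_lift g (repr t).
have fE r : f (to_tensor r) = malg_lift g r.
  apply/eqP; rewrite -subr_eq0 -linearB; apply/eqP/ker.
  by apply/to_tensor_eq; exact: to_tensor_repr.
have flin : linear f.
  move=> a t u; rewrite -[t]to_tensor_repr -[u]to_tensor_repr.
  by rewrite -to_tensorZ -to_tensorD !fE linearD linearZ.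
pose fL := GRing.isLinear.Build _ _ _ _ f flin.
pose F : {linear tensor E -> L} := HB.pack f fL.
by exists F => x; rewrite /F /= fE malg_liftU.
Qed.

Definition tensor_lift {L : lmodType R} {g : tuples E -> L}
  (glin : multilinear g) : {linear tensor E -> L} := sval (tensor_lift_ex glin).

Lemma tensor_liftE {L : lmodType R} {g : tuples E -> L} (glin : multilinear g) x :
  tensor_lift glin (pure_tensor x) = g x.
Proof. exact: (svalP (tensor_lift_ex glin)). Qed.

End TensorLift.

(** * Zero-neighbourhoods and continuity at zero in topological vector spaces *)

Section TopologicalLmodule.
Context {R : realType}.

(** Continuity of scaling at the origin gives [d] and [W] such that all multiples of [W] by scalars
    of absolute value below [d] lie in [A]; together these multiples form a balanced set. *)
Lemma nbhs0_balanced (V : topologicalLmodType R) (A : set V) : nbhs 0 A ->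
  exists2 B, balanced B /\ nbhs 0 B & B `<=` A.
Proof.
move=> A0.
have := @scale_continuous R V (0, 0) A.
rewrite /= scale0r => /(_ A0)[[/= D W] [D0 W0] DWA].
have [/= d d0 dD] := (iffLR (nbhs_ballP _ _) D0).
exists [set v | exists2 a : R, `|a| < d & exists2 w, W w & v = a *: w]; last first.
  move=> _ [a ad [w Ww ->]]; apply: (DWA (a, w)); split => //=.
  by apply: dD; rewrite /ball /= sub0r normrN.
split.
  move=> b _ b1 [a ad [w Ww ->]]; exists (b * a); last first.
    by exists w => //; rewrite scalerA.
  by rewrite normrM (le_lt_trans _ ad)// ler_piMl.
(* The balanced set is a zero-neighbourhood because it contains [(d / 2) *: W]: for [v] close to 0,
   the vector [(d / 2)^-1 *: v] lies in [W]. *)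
have d20 : d / 2 != 0 by rewrite gt_eqF// divr_gt0.
have := @scale_continuous R V ((d / 2)^-1, 0) W.
rewrite /= scaler0 => /(_ W0)[[/= D' W'] [D'0 W'0] DWW].
apply: filterS W'0 => v W'v.
exists (d / 2).
  by rewrite gtr0_norm ?divr_gt0// ltr_pdivrMr// ltr_pMr// ltr1n.
exists ((d / 2)^-1 *: v); last by rewrite scalerA divff// scale1r.
by apply: (DWW (_, _)); split => //=; exact: nbhs_singleton.
Qed.

Lemma nbhs0_halve (V : topologicalLmodType R) (A : set V) : nbhs 0 A ->
  exists2 B, nbhs 0 B & forall u v, B u -> B v -> A (u + v).
Proof.
move=> A0; have := @add_continuous V (0, 0) A.
rewrite /= addr0 => /(_ A0)[[/= B C] [B0 C0] BCA].
exists (B `&` C); first exact: filterI.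
by move=> u v [Bu _] [_ Cv]; exact: (BCA (u, v)).
Qed.

(** Iterated halving, starting from [A], yields sets each of which contains the sum of two copies of
    the next; a finite sum with one term from each successive set then collapses into [A]. *)
Lemma nbhs0_seq_sums (V : topologicalLmodType R) (A : set V) : nbhs 0 A ->
  exists2 B : nat -> set V, (forall l, nbhs 0 (B l)) &
    forall k (v : nat -> V), (forall l, B l (v l)) -> A (\sum_(l < k) v l).
Proof.
move=> A0.
have step (C : {C : set V | nbhs 0 C}) : {D : {D : set V | nbhs 0 D} |
    forall u v, sval D u -> sval D v -> sval C (u + v)}.
  by apply: cid; case: C => C C0; have [B B0 BC] := nbhs0_halve C0;
    exists (exist _ B B0).
pose B l := iter l (fun C => sval (step C)) (exist _ A A0).
have BB l u v : sval (B l.+1) u -> sval (B l.+1) v -> sval (B l) (u + v).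
  exact: (svalP (step (B l))).
exists (fun l => sval (B l.+1)); first by move=> l; exact: svalP.
(* The induction needs every starting level [p]: the first term and the remaining sum both lie in
   [B p.+1], so their total lies in [B p]. *)
move=> k v vB; suff : forall p, sval (B p) (\sum_(l < k) v (p + l)%N) by move=> /(_ 0%N).
elim: k => [|k IHk] p.
  by rewrite big_ord0; apply: nbhs_singleton; exact: (svalP (B p)).
rewrite big_ord_recl addn0; apply: BB; first exact: vB.
by under eq_bigr do rewrite /= /bump add1n -addSnnS; exact: IHk.
Qed.

Lemma linear_continuous0 (V W : topologicalLmodType R) (f : {linear V -> W}) :
  (forall A, nbhs 0 A -> nbhs 0 (f @^-1` A)) -> continuous f.
Proof.
move=> f0 v A /= Afv.
have tr (U : topologicalLmodType R) (u w : U) (C : set U) :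
    nbhs (u + w) C -> nbhs w [set x | C (u + x)].
  move=> Cuw; have [[/= D D'] [Du Dw] DDC] := @add_continuous U (u, w) C Cuw.
  by apply: filterS Dw => x D'x; apply: (DDC (u, x)); split => //=;
    exact: nbhs_singleton.
have A0 : nbhs 0 [set w | A (f v + w)] by apply: tr; rewrite addr0.
have := f0 _ A0; rewrite -{1}(addNr v) => /tr; apply: filterS => u /=.
by rewrite linearD linearN addrA subrr add0r.
Qed.

Definition functional_polar (V : lmodType R) (I : Type) (f : I -> {linear V -> R^o})
  (e : R) : set V := [set v | forall i, `|f i v| <= e].

Lemma functional_polar_nbhs0 (V : topologicalLmodType R) (I : finType)
    (f : I -> {linear V -> R^o}) (e : R) :
  (forall i, continuous (f i)) -> 0 < e ->
  balanced (functional_polar f e) /\ nbhs 0 (functional_polar f e).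
Proof.
move=> fc e0; split.
  move=> a v a1 vf i; rewrite linearZ /= normrM (le_trans _ (vf i))//.
  by rewrite ler_piMl.
apply: (@filter_forall V I (fun i => [set v | `|f i v| <= e]) (nbhs (0 : V))).
move=> i; have f0 : nbhs (0 : V) (f i @^-1` ball (0 : R^o) e).
  by apply: fc; rewrite linear0; exact: nbhsx_ballx.
apply: filterS f0 => v /=.
by rewrite /ball /= sub0r normrN => /ltW.
Qed.

Lemma nbhs0_absorb (V : topologicalLmodType R) (A : set V) v : nbhs 0 A ->
  exists2 a : R, a != 0 & A (a *: v).
Proof.
move=> A0; have := @scale_continuous R V (0, v) A.
rewrite /= scale0r => /(_ A0)[[/= D W] [D0 Wv] DWA].
have [/= d d0 dD] := (iffLR (nbhs_ballP _ _) D0).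
exists (d / 2); first by rewrite gt_eqF// divr_gt0.
apply: (DWA (_, _)); split => /=; last exact: nbhs_singleton.
apply: dD; rewrite /ball /= sub0r normrN gtr0_norm ?divr_gt0//.
by rewrite ltr_pdivrMr// ltr_pMr// ltr1n.
Qed.

Lemma open_map_nbhs0 (V W : topologicalLmodType R) (f : {linear V -> W}) N :
  open_map f -> nbhs 0 N -> nbhs 0 (f @` N).
Proof.
move=> fo; rewrite nbhsE => -[G [Go G0] GN].
rewrite nbhsE; exists (f @` G); last exact: image_subset.
by split; [exact: fo|exists 0 => //; exact: linear0].
Qed.

End TopologicalLmodule.

(** * Continuity criterion for linear maps on a tensor product *)

Section TensorLiftContinuous.
Context {R : realType} {n : nat}.
Context {E : 'I_n.+2 -> topologicalLmodType R}.

Definition continuous_at0 {L : topologicalLmodType R} (g : tuples E -> L) : Prop :=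
  forall A, nbhs 0 A -> exists2 U : forall j, set (E j), (forall j, nbhs 0 (U j)) &
    forall x : tuples E, (forall j, U j (x j)) -> A (g x).

(** Here the sequences in the basic neighbourhoods matter: the [l]-th summand can be kept so small
    that [f] sends it into [B l], and finite sums with one term from each [B l] stay in [A]. *)
Lemma tensor_linear_continuous (L : topologicalLmodType R)
    (f : {linear tensor E -> L}) :
  continuous_at0 (f \o @pure_tensor R n E) -> continuous f.
Proof.
move=> f0; apply: linear_continuous0 => A A0.
have [B B0 BA] := nbhs0_seq_sums A0.
have /choice [U UB] : forall l, exists U : forall j, set (E j),
    (forall j, balanced (U j) /\ nbhs 0 (U j)) /\
    forall x : tuples E, (forall j, U j (x j)) -> B l (f (pure_tensor x)).
  move=> l; have [U U0 UB] := f0 _ (B0 l).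
  (* Basic neighbourhoods are built from balanced sets, hence the shrinking. *)
  have W j : {W | balanced W /\ nbhs 0 W & W `<=` U j}.
    by apply: cid2; exact: nbhs0_balanced (U0 j).
  exists (fun j => s2val (W j)); split; first by move=> j; exact: (s2valP (W j)).
  by move=> x Wx; apply: UB => j; exact: (s2valP' (W j)).
apply/tensor_nbhs0P; exists (fun j l => U l j).
  by move=> j l; exact: (UB l).1.
have Ub : balanced_nbhs0_seqs (fun j l => U l j) by move=> j l; exact: (UB l).1.
move=> t /(tensor_basic_nbhs0_elim Ub)[x Ux [k /(_ k (leqnn k)) ->]] /=.
rewrite linear_sum; apply: (BA k (fun l => f (pure_tensor (x l)))) => l.
by apply: (UB l).2 => j; exact: Ux.
Qed.

Lemma pure_tensor_continuous_at0 : continuous_at0 (@pure_tensor R n E).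
Proof.
move=> A /tensor_nbhs0P[U Ub UA]; exists (fun j => U j 0%N).
  by move=> j; exact: (Ub j 0%N).2.
move=> x Ux; apply: UA; exists 0%N => //; exists (fun=> x); last by rewrite big_ord1.
by move=> l j; rewrite ord1; exact: Ux.
Qed.

End TensorLiftContinuous.

(** * Two-fold and three-fold tensor products *)

Definition bilinear_map {R : realType} {A B L : lmodType R} (g : A -> B -> L) :=
  (forall b, linear (g^~ b)) /\ (forall a, linear (g a)).

Definition trilinear_map {R : realType} {A B C L : lmodType R}
    (g : A -> B -> C -> L) :=
  [/\ forall b c, linear (fun a => g a b c), forall a c, linear (fun b => g a b c)
    & forall a b, linear (fun c => g a b c)].

Lemma bilinear_suml (R : realType) (X Y L : lmodType R) (g : X -> Y -> L) (I : Type)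
    (s : seq I) (f : I -> X) y : bilinear_map g ->
  g (\sum_(i <- s) f i) y = \sum_(i <- s) g (f i) y.
Proof.
move=> [gl _]; pose G : {linear X -> L} :=
  HB.pack (g^~ y) (GRing.isLinear.Build _ _ _ _ (g^~ y) (gl y)).
exact: (linear_sum G).
Qed.

Lemma bilinear_sumr (R : realType) (X Y L : lmodType R) (g : X -> Y -> L) (I : Type)
    (s : seq I) (f : I -> Y) x : bilinear_map g ->
  g x (\sum_(i <- s) f i) = \sum_(i <- s) g x (f i).
Proof.
move=> [_ gr]; pose G : {linear Y -> L} :=
  HB.pack (g x) (GRing.isLinear.Build _ _ _ _ (g x) (gr x)).
exact: (linear_sum G).
Qed.

Section Tensor2.
Context {R : realType} {A B : topologicalLmodType R}.

Let i0 : 'I_2 := @Ordinal 2 0 isT.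
Let i1 : 'I_2 := @Ordinal 2 1 isT.

Let ord2P (P : 'I_2 -> Prop) : P i0 -> P i1 -> forall i, P i.
Proof.
move=> P0 P1 [[|[|//]] Hi]; first by rewrite (_ : Ordinal _ = i0)//; exact: val_inj.
by rewrite (_ : Ordinal _ = i1)//; exact: val_inj.
Qed.

(** The parameter [P] lets one dependent match build both tuples of vectors and families of
    neighbourhoods. *)
Definition family2_tuple (P : topologicalLmodType R -> Type) (a : P A) (b : P B)
    (i : 'I_2) : P (family2 A B i) :=
  match val i as k
    return P (match k with 0%N => A | _ => B end : topologicalLmodType R)
  with 0%N => a | _ => b end.
Arguments family2_tuple P a b i : clear implicits.

Lemma pure_tensor2E (x : tuples (family2 A B)) :
  pure_tensor x = pure2 (x i0 : A) (x i1 : B).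
Proof.
rewrite /pure2; congr pure_tensor; apply: functional_extensionality_dep.
by apply: ord2P.
Qed.

Lemma tensor2_span (t : tensor2 A B) :
  exists s : seq (A * B), t = \sum_(p <- s) pure2 p.1 p.2.
Proof.
have [s ->] := tensor_span t.
exists [seq (x i0 : A, x i1 : B) | x : tuples (family2 A B) <- s].
by rewrite big_map; apply: eq_bigr => x _; exact: pure_tensor2E.
Qed.

Lemma tensor2_lift (L : lmodType R) (g : A -> B -> L) : bilinear_map g ->
  exists f : {linear tensor2 A B -> L}, forall a b, f (pure2 a b) = g a b.
Proof.
move=> [gl gr].
have glin : multilinear (fun x : tuples (family2 A B) => g (x i0) (x i1)).
  move=> x; apply: ord2P => a u v.
    by rewrite !dfwithin !dfwithout//; exact: gl.
  by rewrite !dfwithin !dfwithout//; exact: gr.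
by exists (tensor_lift glin) => a b; exact: tensor_liftE.
Qed.

Lemma pure2_bilinear : bilinear_map (@pure2 R A B).
Proof.
split=> [b|a] c u v.
  (* The entry 0 is a placeholder, overwritten when the slot [i0] is updated. *)
  have := @pure_tensor_linear R 0 (family2 A B) (family2_tuple (fun E => E) 0 b) i0 c u v.
  by rewrite /= !pure_tensor2E !dfwithin !dfwithout.
have := @pure_tensor_linear R 0 (family2 A B) (family2_tuple (fun E => E) a 0) i1 c u v.
by rewrite /= !pure_tensor2E !dfwithin !dfwithout.
Qed.

Lemma tensor2_linear_continuous (L : topologicalLmodType R)
    (f : {linear tensor2 A B -> L}) :
  (forall N, nbhs 0 N -> exists U V, [/\ nbhs 0 U, nbhs 0 V &
    forall a b, U a -> V b -> N (f (pure2 a b))]) -> continuous f.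
Proof.
move=> f0; apply: tensor_linear_continuous => N /f0[U [V [U0 V0 UVN]]].
exists (family2_tuple (fun E => set E) U V); first by apply: ord2P.
by move=> x UVx; rewrite /= pure_tensor2E; apply: UVN; [exact: (UVx i0)|exact: (UVx i1)].
Qed.

Lemma pure2_continuous0 (N : set (tensor2 A B)) : nbhs 0 N ->
  exists U V, [/\ nbhs 0 U, nbhs 0 V & forall a b, U a -> V b -> N (pure2 a b)].
Proof.
move=> /pure_tensor_continuous_at0[U U0 UN].
exists (U i0), (U i1); split; [exact: (U0 i0)|exact: (U0 i1)|].
by move=> a b Ua Vb; apply: UN; apply: ord2P.
Qed.

(** Supplies the neighbourhoods of the counterexample. The sequences satisfy their bounds at every
    index, so later estimates need no case distinction at [k]. *)
Lemma tensor2_basic_nbhs0 (U : nat -> set A) (V : nat -> set B) :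
  (forall l, balanced (U l) /\ nbhs 0 (U l)) ->
  (forall l, balanced (V l) /\ nbhs 0 (V l)) ->
  nbhs (0 : tensor2 A B) [set t | exists k a b,
    [/\ forall l, U l (a l), forall l, V l (b l) &
        t = \sum_(l < k) pure2 (a l) (b l)]].
Proof.
move=> Ub Vb.
pose W j l := family2_tuple (fun E => set E) (U l) (V l) j.
have Wb : balanced_nbhs0_seqs W by apply: ord2P.
apply/tensor_nbhs0P; exists W => // t /(tensor_basic_nbhs0_elim Wb)[x Wx [k xE]].
exists k, (fun l => x l i0 : A), (fun l => x l i1 : B); split.
- by move=> l; exact: (Wx l i0).
- by move=> l; exact: (Wx l i1).
- by rewrite (xE k)//; apply: eq_bigr => l _; exact: pure_tensor2E.
Qed.

End Tensor2.

Section Tensor3.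
Context {R : realType} {A B C : topologicalLmodType R}.

Let i0 : 'I_3 := @Ordinal 3 0 isT.
Let i1 : 'I_3 := @Ordinal 3 1 isT.
Let i2 : 'I_3 := @Ordinal 3 2 isT.

Let ord3P (P : 'I_3 -> Prop) : P i0 -> P i1 -> P i2 -> forall i, P i.
Proof.
move=> P0 P1 P2 [[|[|[|//]]] Hi].
- by rewrite (_ : Ordinal _ = i0)//; exact: val_inj.
- by rewrite (_ : Ordinal _ = i1)//; exact: val_inj.
- by rewrite (_ : Ordinal _ = i2)//; exact: val_inj.
Qed.

Definition family3_tuple (P : topologicalLmodType R -> Type)
    (a : P A) (b : P B) (c : P C) (i : 'I_3) : P (family3 A B C i) :=
  match val i as k
    return P (match k with 0%N => A | 1%N => B | _ => C end
              : topologicalLmodType R)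
  with 0%N => a | 1%N => b | _ => c end.
Arguments family3_tuple P a b c i : clear implicits.

Lemma pure_tensor3E (x : tuples (family3 A B C)) :
  pure_tensor x = pure3 (x i0 : A) (x i1 : B) (x i2 : C).
Proof.
rewrite /pure3; congr pure_tensor; apply: functional_extensionality_dep.
by apply: ord3P.
Qed.

Lemma tensor3_span (t : tensor3 A B C) :
  exists s : seq (A * B * C), t = \sum_(p <- s) pure3 p.1.1 p.1.2 p.2.
Proof.
have [s ->] := tensor_span t.
exists [seq (x i0 : A, x i1 : B, x i2 : C) | x : tuples (family3 A B C) <- s].
by rewrite big_map; apply: eq_bigr => x _; exact: pure_tensor3E.
Qed.

Lemma tensor3_lift (L : lmodType R) (g : A -> B -> C -> L) : trilinear_map g ->
  exists f : {linear tensor3 A B C -> L}, forall a b c, f (pure3 a b c) = g a b c.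
Proof.
move=> [g0 g1 g2].
have glin : multilinear (fun x : tuples (family3 A B C) => g (x i0) (x i1) (x i2)).
  move=> x; apply: ord3P => a u v.
  - by rewrite !dfwithin !dfwithout//; exact: g0.
  - by rewrite !dfwithin !dfwithout//; exact: g1.
  - by rewrite !dfwithin !dfwithout//; exact: g2.
by exists (tensor_lift glin) => a b c; exact: tensor_liftE.
Qed.

Lemma pure3_trilinear : trilinear_map (@pure3 R A B C).
Proof.
split=> [b c|a c|a b] d u v.
- have := @pure_tensor_linear R 1 (family3 A B C) (family3_tuple (fun E => E) 0 b c) i0 d u v.
  by rewrite /= !pure_tensor3E !dfwithin !dfwithout.
- have := @pure_tensor_linear R 1 (family3 A B C) (family3_tuple (fun E => E) a 0 c) i1 d u v.
  by rewrite /= !pure_tensor3E !dfwithin !dfwithout.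
- have := @pure_tensor_linear R 1 (family3 A B C) (family3_tuple (fun E => E) a b 0) i2 d u v.
  by rewrite /= !pure_tensor3E !dfwithin !dfwithout.
Qed.

Lemma tensor3_linear_continuous (L : topologicalLmodType R)
    (f : {linear tensor3 A B C -> L}) :
  (forall N, nbhs 0 N -> exists U V W, [/\ nbhs 0 U, nbhs 0 V, nbhs 0 W &
    forall a b c, U a -> V b -> W c -> N (f (pure3 a b c))]) -> continuous f.
Proof.
move=> f0; apply: tensor_linear_continuous => N /f0[U [V [W [U0 V0 W0 UN]]]].
exists (family3_tuple (fun E => set E) U V W); first by apply: ord3P.
move=> x Ux; rewrite /= pure_tensor3E.
by apply: UN; [exact: (Ux i0)|exact: (Ux i1)|exact: (Ux i2)].
Qed.

Lemma tensor3_basic_nbhs0 (U : nat -> set A) (V : nat -> set B) (W : nat -> set C) :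
  (forall l, balanced (U l) /\ nbhs 0 (U l)) ->
  (forall l, balanced (V l) /\ nbhs 0 (V l)) ->
  (forall l, balanced (W l) /\ nbhs 0 (W l)) ->
  nbhs (0 : tensor3 A B C) [set t | exists k a b c,
    [/\ forall l, U l (a l), forall l, V l (b l), forall l, W l (c l) &
        t = \sum_(l < k) pure3 (a l) (b l) (c l)]].
Proof.
move=> Ub Vb Wb.
pose N j l := family3_tuple (fun E => set E) (U l) (V l) (W l) j.
have Nb : balanced_nbhs0_seqs N by apply: ord3P.
apply/tensor_nbhs0P; exists N => // t /(tensor_basic_nbhs0_elim Nb)[x Nx [k xE]].
exists k, (fun l => x l i0 : A), (fun l => x l i1 : B), (fun l => x l i2 : C); split.
- by move=> l; exact: (Nx l i0).
- by move=> l; exact: (Nx l i1).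
- by move=> l; exact: (Nx l i2).
- by rewrite (xE k)//; apply: eq_bigr => l _; exact: pure_tensor3E.
Qed.

End Tensor3.

(** * Rebracketing maps between threefold tensor products *)

Section Associators.
Context {R : realType} {A B C : topologicalLmodType R}.

Lemma tensor21_ext (L : lmodType R) (f h : {linear tensor2 (tensor2 A B) C -> L}) :
  (forall a b c, f (pure2 (pure2 a b) c) = h (pure2 (pure2 a b) c)) -> f =1 h.
Proof.
move=> fh t; have [s ->] := tensor2_span t.
rewrite !linear_sum; apply: eq_bigr => -[w c] _ /=.
have [r ->] := tensor2_span w.
rewrite (bilinear_suml _ _ _ pure2_bilinear) !linear_sum.
by apply: eq_bigr => p _; exact: fh.
Qed.

Lemma tensor12_ext (L : lmodType R) (f h : {linear tensor2 A (tensor2 B C) -> L}) :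
  (forall a b c, f (pure2 a (pure2 b c)) = h (pure2 a (pure2 b c))) -> f =1 h.
Proof.
move=> fh t; have [s ->] := tensor2_span t.
rewrite !linear_sum; apply: eq_bigr => -[a w] _ /=.
have [r ->] := tensor2_span w.
rewrite (bilinear_sumr _ _ _ pure2_bilinear) !linear_sum.
by apply: eq_bigr => p _; exact: fh.
Qed.

Lemma tensor3_ext (L : lmodType R) (f h : {linear tensor3 A B C -> L}) :
  (forall a b c, f (pure3 a b c) = h (pure3 a b c)) -> f =1 h.
Proof.
move=> fh t; have [s ->] := tensor3_span t.
by rewrite !linear_sum; apply: eq_bigr => p _; exact: fh.
Qed.

(** The universal property is applied twice. The inner lift [F c] is chosen separately for each [c],
    so linearity in [c] is checked by writing [w] as a sum of elementary tensors. *)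
Lemma tensor21_lift (L : lmodType R) (g : A -> B -> C -> L) : trilinear_map g ->
  exists f : {linear tensor2 (tensor2 A B) C -> L},
    forall a b c, f (pure2 (pure2 a b) c) = g a b c.
Proof.
move=> [g0 g1 g2].
have /choice[F FE] : forall c, exists f : {linear tensor2 A B -> L},
    forall a b, f (pure2 a b) = g a b c.
  by move=> c; apply: (tensor2_lift (g := fun a b => g a b c)); split.
have [|f fE] := @tensor2_lift _ _ _ L (fun w c => F c w); last first.
  by exists f => a b c; rewrite fE FE.
split=> [c|w] a u v; first exact: linearP.
have [s ->] := tensor2_span w; rewrite /= !linear_sum -big_split.
by apply: eq_bigr => p _; rewrite /= !FE; exact: g2.
Qed.

Lemma tensor12_lift (L : lmodType R) (g : A -> B -> C -> L) : trilinear_map g ->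
  exists f : {linear tensor2 A (tensor2 B C) -> L},
    forall a b c, f (pure2 a (pure2 b c)) = g a b c.
Proof.
move=> [g0 g1 g2].
have /choice[F FE] : forall a, exists f : {linear tensor2 B C -> L},
    forall b c, f (pure2 b c) = g a b c.
  by move=> a; apply: (tensor2_lift (g := fun b c => g a b c)); split.
have [|f fE] := @tensor2_lift _ _ _ L (fun a w => F a w); last first.
  by exists f => a b c; rewrite fE FE.
split=> [w|w] a u v; last exact: linearP.
have [s ->] := tensor2_span w; rewrite /= !linear_sum -big_split.
by apply: eq_bigr => p _; rewrite /= !FE; exact: g0.
Qed.

Lemma pure21_trilinear :
  trilinear_map (fun (a : A) (b : B) (c : C) => pure2 (pure2 a b) c).
Proof.
have [l r] := @pure2_bilinear R A B.
have [l' r'] := @pure2_bilinear R (tensor2 A B) C.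
split=> [b c|a c|a b] d u v; last exact: r'.
- by rewrite l l'.
- by rewrite r l'.
Qed.

Lemma pure12_trilinear :
  trilinear_map (fun (a : A) (b : B) (c : C) => pure2 a (pure2 b c)).
Proof.
have [l r] := @pure2_bilinear R B C.
have [l' r'] := @pure2_bilinear R A (tensor2 B C).
split=> [b c|a c|a b] d u v; first exact: l'.
- by rewrite l r'.
- by rewrite r r'.
Qed.

(** The inverse comes from the universal property of the iterated product; both composites fix the
    elementary tensors, which span. *)
Lemma phi_bijective (f : {linear tensor3 A B C -> tensor2 (tensor2 A B) C}) :
  is_phi f -> bijective f.
Proof.
move=> fE; have [g gE] := tensor21_lift (@pure3_trilinear R A B C).
exists g.
  by apply: (tensor3_ext (f := g \o f) (h := idfun)) => a b c; rewrite /= fE gE.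
by apply: (tensor21_ext (f := f \o g) (h := idfun)) => a b c; rewrite /= gE fE.
Qed.

Lemma psi_bijective (f : {linear tensor3 A B C -> tensor2 A (tensor2 B C)}) :
  is_psi f -> bijective f.
Proof.
move=> fE; have [g gE] := tensor12_lift (@pure3_trilinear R A B C).
exists g.
  by apply: (tensor3_ext (f := g \o f) (h := idfun)) => a b c; rewrite /= fE gE.
by apply: (tensor12_ext (f := f \o g) (h := idfun)) => a b c; rewrite /= gE fE.
Qed.

Lemma theta_bijective
    (f : {linear tensor2 (tensor2 A B) C -> tensor2 A (tensor2 B C)}) :
  is_theta f -> bijective f.
Proof.
move=> fE; have [g gE] := tensor12_lift pure21_trilinear.
exists g.
  by apply: (tensor21_ext (f := g \o f) (h := idfun)) => a b c; rewrite /= fE gE.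
by apply: (tensor12_ext (f := f \o g) (h := idfun)) => a b c; rewrite /= gE fE.
Qed.

(** Continuity of [pure2] at zero, used for the outer and then the inner product, gives three
    neighbourhoods whose elementary tensors land in [N]. *)
Lemma phi_continuous (f : {linear tensor3 A B C -> tensor2 (tensor2 A B) C}) :
  is_phi f -> continuous f.
Proof.
move=> fE; apply: tensor3_linear_continuous => N.
move=> /pure2_continuous0[U [V [/pure2_continuous0[X [Y [X0 Y0 XYU]]] V0 UVN]]].
exists X, Y, V; split=> // a b c Xa Yb Vc; rewrite fE.
by apply: UVN => //; exact: XYU.
Qed.

Lemma psi_continuous (f : {linear tensor3 A B C -> tensor2 A (tensor2 B C)}) :
  is_psi f -> continuous f.
Proof.
move=> fE; apply: tensor3_linear_continuous => N.
move=> /pure2_continuous0[U [V [U0 /pure2_continuous0[X [Y [X0 Y0 XYV]]] UVN]]].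
exists U, X, Y; split=> // a b c Ua Xb Yc; rewrite fE.
by apply: UVN => //; exact: XYV.
Qed.

End Associators.

(** * A rank obstruction for scalar matrices *)

Lemma geometric_half_le1 (R : realFieldType) k : \sum_(l < k) 2^-1 ^+ l.+1 <= 1 :> R.
Proof.
suff -> : \sum_(l < k) 2^-1 ^+ l.+1 = 1 - 2^-1 ^+ k :> R.
  by rewrite gerBl exprn_ge0// invr_ge0.
elim: k => [|k IHk]; first by rewrite big_ord0 expr0 subrr.
by rewrite big_ord_recr /= IHk exprS; field.
Qed.

(** The diagonal value [m.+2] is chosen to exceed the number [m.+1] of rows in the corner: against a
    vector with largest entry [c 0 j], the terms with [l >= m] contribute at most [m.+1] times its
    absolute value, since the bounds on [v] sum to at most 1. *)
Lemma scalar_mx_not_low_rank_plus_small (R : realFieldType) (m k : nat)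
    (u v : nat -> nat -> R) :
  (forall l i, (m <= l)%N -> (i <= m)%N -> `|u l i| <= 1) ->
  (forall l j, (m <= l)%N -> (j <= m)%N -> `|v l j| <= 2^-1 ^+ l.+1) ->
  ~ (forall i j, (i <= m)%N -> (j <= m)%N ->
       \sum_(l < k) u l i * v l j = m.+2%:R *+ (i == j)).
Proof.
move=> u1 v1 uvE.
have lo (i : 'I_m.+1) : (i <= m)%N by rewrite -ltnS.
(* c kills the terms l < m, whose factors are arbitrary; its largest entry then
   contradicts the bounds on the remaining terms. *)
pose U : 'M[R]_(m.+1, m) := \matrix_(i, l) u l i.
(* [U] has [m.+1] rows and [m] columns, so its left kernel is nonzero. *)
have [c cU c0] : exists2 c : 'rV_m.+1, c *m U = 0 & c != 0.
  have : kermx U != 0.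
    rewrite kermx_eq0 /row_free; apply: contraL (rank_leq_col U) => /eqP ->.
    by rewrite ltnn.
  by move=> /rowV0Pn[c /sub_kermxP cU c0]; exists c.
pose j := [arg max_(j > (ord0 : 'I_m.+1)) `|c 0 j|]%O.
have cj i : `|c 0 i| <= `|c 0 j|.
  by rewrite /j; case: arg_maxP => //= j' _; exact.
have cj0 : 0 < `|c 0 j|.
  rewrite normr_gt0; apply: contra c0 => /eqP cj0; apply/eqP/rowP => i.
  by rewrite mxE; apply/eqP; have := cj i; rewrite cj0 normr0 normr_le0.
have cu (l : nat) : (l < m)%N -> \sum_(i < m.+1) c 0 i * u l i = 0.
  move=> lm; have /rowP/(_ (Ordinal lm)) := cU; rewrite !mxE => cU0; rewrite -[RHS]cU0.
  by apply: eq_bigr => i _; rewrite mxE.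
(* Entry [j] of [c] times the whole matrix is read off the scalar matrix on one side and off the sum
   of rank-one terms on the other. *)
have cE : m.+2%:R * c 0 j = \sum_(l < k) (\sum_(i < m.+1) c 0 i * u l i) * v l j.
  transitivity (\sum_(i < m.+1) c 0 i * \sum_(l < k) u l i * v l j).
    rewrite (bigD1 j)//= [X in _ + X]big1 ?addr0.
      by rewrite (uvE _ _ (lo _) (lo _)) eqxx mulrC.
    by move=> i ij; rewrite (uvE _ _ (lo _) (lo _)) val_eqE (negbTE ij) mulr0.
  under eq_bigr do rewrite mulr_sumr.
  rewrite exchange_big /=; apply: eq_bigr => l _; rewrite mulr_suml.
  by apply: eq_bigr => i _; rewrite mulrA.
have : m.+2%:R * `|c 0 j| <= m.+1%:R * `|c 0 j|.
  rewrite -[X in X * _ <= _]normr_nat -normrM cE.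
  apply: (le_trans (ler_norm_sum _ _ _)).
  apply: (@le_trans _ _ (\sum_(l < k) m.+1%:R * `|c 0 j| * 2^-1 ^+ l.+1)).
    apply: ler_sum => l _; rewrite normrM.
    have [lm|ml] := ltnP l m.
      by rewrite cu// normr0 mul0r !mulr_ge0// exprn_ge0// invr_ge0.
    apply: ler_pM => //; last by apply: v1 => //; rewrite -ltnS.
    apply: (le_trans (ler_norm_sum _ _ _)).
    have -> : m.+1%:R * `|c 0 j| = \sum_(i < m.+1) `|c 0 j|.
      by rewrite sumr_const card_ord mulr_natl.
    apply: ler_sum => i _; rewrite normrM -[leRHS]mulr1.
    by apply: ler_pM => //; apply: u1 => //; rewrite -ltnS.
  rewrite -mulr_sumr -[leRHS]mulr1 ler_wpM2l ?mulr_ge0//.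
  exact: geometric_half_le1.
by rewrite ler_pM2r// ler_nat ltnn.
Qed.

(** * The space of real sequences and the counterexample *)

Section Sequences.
Variable R : realType.
Local Notation E := (real_seq R : topologicalLmodType R).

Definition seq_coord (k : nat) (x : E) : R^o := x k.

Lemma seq_coord_linear k : linear (seq_coord k). Proof. by []. Qed.
HB.instance Definition _ k := GRing.isLinear.Build _ _ _ _ (seq_coord k)
  (seq_coord_linear k).

Lemma seq_coord_continuous k : continuous (seq_coord k).
Proof. exact: real_seq_proj_continuous. Qed.

Definition seq_unit (m : nat) : E := fun i => (i == m)%:R : R^o.

(** A zero-neighbourhood of the product topology constrains only finitely many coordinates, so some
    coordinate direction is free. The proof replaces a basis of neighbourhoods by a convergent
    sequence. *)
Lemma nbhs0_line (V : set E) : nbhs 0 V -> exists m, forall t : R, V (t *: seq_unit m).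
Proof.
move=> V0; apply: contrapT => noline.
have /choice[t tV] m : exists t : R, ~ V (t *: seq_unit m).
  apply: contrapT => tV; apply: noline; exists m => t.
  by apply: contrapT => nV; apply: tV; exists t.
(* Pointwise, t m *: seq_unit m is eventually 0, however t grows. *)
suff /(_ _ V0) [n _ /(_ n (leqnn n))] :
    (fun m => t m *: seq_unit m : E) @ \oo --> (0 : E).
  exact: tV.
apply/cvg_sup => k A; rewrite nbhsE => -[_ [[C oC <-] C0] CA].
exists k.+1 => // m /= km; apply: CA => /=.
rewrite /= (_ : (t m *: seq_unit m) k = 0)//.
by rewrite /GRing.scale /= /seq_unit ltn_eqF// [LHS]mulr0.
Qed.

(** With elements of [tensor2 E E] read as matrices, this is the entry at [(i, j)]. Its continuity
    makes bounds on finitely many entries define zero-neighbourhoods. *)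
Lemma seq_coef_ex i j : {f : {linear tensor2 E E -> R^o} |
  continuous f /\ forall x y : E, f (pure2 x y) = x i * y j}.
Proof.
apply: cid.
have [|f fE] := @tensor2_lift _ E E R^o (fun x y => x i * y j : R^o).
  split=> [y|x] a u v.
    by rewrite [(a *: u + v) i]/(a * u i + v i) mulrDl -mulrA.
  by rewrite [(a *: u + v) j]/(a * u j + v j) mulrDr mulrCA.
exists f; split=> //; apply: tensor2_linear_continuous => N.
move=> /nbhs_ballP[e /= e0 eN].
(* Halving [e] turns the weak bounds of the polars into the strict inequality of the ball. *)
have e20 : 0 < e / 2 by rewrite divr_gt0.
exists (functional_polar (fun _ : unit => seq_coord i) 1).
exists (functional_polar (fun _ : unit => seq_coord j) (e / 2)).
split.
- apply: (functional_polar_nbhs0 _ _).2 => // _; exact: seq_coord_continuous.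
- apply: (functional_polar_nbhs0 _ _).2 => // _; exact: seq_coord_continuous.
move=> x y /(_ tt) xi /(_ tt) yj; apply: eN.
rewrite fE /ball /= sub0r normrN normrM (@le_lt_trans _ _ (1 * (e / 2)))//.
  exact: ler_pM.
by rewrite mul1r ltr_pdivrMr// ltr_pMr// ltr1n.
Qed.

Definition seq_coef i j : {linear tensor2 E E -> R^o} := sval (seq_coef_ex i j).

Lemma seq_coef_continuous i j : continuous (seq_coef i j).
Proof. exact: (svalP (seq_coef_ex i j)).1. Qed.

Lemma seq_coefE i j (x y : E) : seq_coef i j (pure2 x y) = x i * y j.
Proof. exact: (svalP (seq_coef_ex i j)).2. Qed.

(** The order of choices matters: [V] fixes [m], which fixes the identity tensor [w0]; a factor [a]
    brings [w0] into [W], and its inverse is absorbed by the line in direction [m], all of which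
    lies in [V]. *)
Lemma scaled_identity_witness (W : set (tensor2 E E)) (V : set E) : nbhs 0 W -> nbhs 0 V ->
  exists m w z, [/\ W w, V z & forall i j, (i <= m)%N -> (j <= m)%N ->
    seq_coef i j w * z m = m.+2%:R *+ (i == j)].
Proof.
move=> W0 /nbhs0_line[m Vm].
pose w0 : tensor2 E E := \sum_(l < m.+1) pure2 (seq_unit l) (seq_unit l).
have [a a0 Wa] := nbhs0_absorb w0 W0.
exists m, (a *: w0), ((m.+2%:R / a) *: seq_unit m); split => // i j im jm.
have -> : ((m.+2%:R / a) *: seq_unit m) m = m.+2%:R / a.
  by rewrite -[LHS]/(m.+2%:R / a * (m == m)%:R) eqxx mulr1.
rewrite linearZ linear_sum /=.
under eq_bigr do rewrite seq_coefE /seq_unit.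
(* Only the summand [l = i] survives; [inord] recovers it as an index because [i <= m]. *)
rewrite (bigD1 (inord i))//= big1 ?addr0.
  rewrite inordK ?ltnS// eqxx mul1r eq_sym.
  rewrite -[LHS]/(a * (i == j)%:R * (m.+2%:R / a)).
  by rewrite mulrC mulrA divfK// mulr_natr.
move=> l li; rewrite (_ : (i == l) = false) ?mul0r//.
by apply: contra_neqF li => /eqP ->; rewrite inord_val.
Qed.

(** An entry functional for three-index arrays: freezing one index at [m] leaves a matrix in the
    other two. *)
Lemma coord_coef_ex i j k : exists h : {linear tensor2 E (tensor2 E E) -> R^o},
  forall x w, h (pure2 x w) = x i * seq_coef j k w.
Proof.
apply: (@tensor2_lift _ E (tensor2 E E) R^o (fun x w => x i * seq_coef j k w : R^o)).
split=> [y|x] a u v.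
  by rewrite [(a *: u + v) i]/(a * u i + v i) mulrDl -mulrA.
by rewrite linearP mulrDr /= mulrCA.
Qed.

(** The index [l] sets both the number of constrained coordinates and a summable bound, so every
    term with [l >= m] is small on all indices up to [m]. *)
Definition coord_nbhs0 (l : nat) : set E :=
  functional_polar (fun i : 'I_l.+1 => seq_coord i) (2^-1 ^+ l.+1).

Definition coef_nbhs0 (l : nat) : set (tensor2 E E) :=
  functional_polar (fun p : 'I_l.+1 * 'I_l.+1 => seq_coef p.1 p.2) (2^-1 ^+ l.+1).

Lemma coord_nbhs0P l : balanced (coord_nbhs0 l) /\ nbhs 0 (coord_nbhs0 l).
Proof.
apply: functional_polar_nbhs0; last by rewrite exprn_gt0// invr_gt0.
by move=> i; exact: seq_coord_continuous.
Qed.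

Lemma coef_nbhs0P l : balanced (coef_nbhs0 l) /\ nbhs 0 (coef_nbhs0 l).
Proof.
apply: functional_polar_nbhs0; last by rewrite exprn_gt0// invr_gt0.
by move=> i; exact: seq_coef_continuous.
Qed.

Lemma coord_nbhs0_le l x i : coord_nbhs0 l x -> (i <= l)%N -> `|x i| <= 2^-1 ^+ l.+1.
Proof. by move=> xl il; have := xl (Ordinal (il : (i < l.+1)%N)). Qed.

Lemma coef_nbhs0_le l w i j : coef_nbhs0 l w -> (i <= l)%N -> (j <= l)%N ->
  `|seq_coef i j w| <= 2^-1 ^+ l.+1.
Proof.
move=> wl il jl.
by have := wl (Ordinal (il : (i < l.+1)%N), Ordinal (jl : (j < l.+1)%N)).
Qed.

Lemma exp_half_le1 l : 2^-1 ^+ l <= 1 :> R.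
Proof. by rewrite exprn_ile1 ?invr_ge0// invf_le1// ler1n. Qed.

Lemma theta_not_continuous
    (theta : {linear tensor2 (tensor2 E E) E -> tensor2 E (tensor2 E E)}) :
  is_theta theta -> ~ continuous theta.
Proof.
move=> thetaE thetac.
have N0 := tensor2_basic_nbhs0 coord_nbhs0P coef_nbhs0P.
rewrite -[X in nbhs X](linear0 theta) in N0.
have [W [V [W0 V0 WVN]]] := pure2_continuous0 (thetac _ _ N0).
have [m [w [z [Ww Vz wz]]]] := scaled_identity_witness W0 V0.
have [k [x [y [xU yV thetawz]]]] := WVN _ _ Ww Vz.
(* Row factors are the coordinates of [x l]; column factors are the entries of [y l] with second
   index frozen at [m]. Both are controlled once [l >= m]. *)
apply: (@scalar_mx_not_low_rank_plus_small R m k x (fun l j => seq_coef j m (y l))).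
- move=> l i ml im; apply: le_trans (exp_half_le1 l.+1).
  by apply: coord_nbhs0_le => //; exact: leq_trans ml.
- by move=> l j ml jm; apply: coef_nbhs0_le => //; exact: leq_trans ml.
move=> i j im jm; rewrite -wz//.
have [h hE] := coord_coef_ex i j m.
transitivity (h (theta (pure2 w z))).
  by rewrite thetawz linear_sum; apply: eq_bigr => l _; rewrite hE.
(* Expanding [w] in elementary tensors identifies the value of [h] with the entry [(i, j)] of [w]
   times [z m]. *)
have [s ->] := tensor2_span w.
rewrite (bilinear_suml _ _ _ pure2_bilinear) !linear_sum mulr_suml.
by apply: eq_bigr => p _; rewrite /= thetaE hE !seq_coefE mulrA.
Qed.

(** Openness would make the image of a basic neighbourhood of [tensor3 E E E] a zero-neighbourhood.
    The line now lies in the first factor, so the first coordinate is the one read at [m]. *)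
Lemma psi_not_open (psi : {linear tensor3 E E E -> tensor2 E (tensor2 E E)}) :
  is_psi psi -> ~ open_map psi.
Proof.
move=> psiE psio.
have := open_map_nbhs0 psio
  (tensor3_basic_nbhs0 coord_nbhs0P coord_nbhs0P coord_nbhs0P).
move=> /pure2_continuous0[V [W [V0 W0 VWN]]].
have [m [w [t [Ww Vt wt]]]] := scaled_identity_witness W0 V0.
have [_ [k [x [y [z [xU yU zU ->]]]]] psitw] := VWN _ _ Vt Ww.
apply: (@scalar_mx_not_low_rank_plus_small R m k (fun l i => x l m * y l i) z).
- move=> l i ml im; rewrite normrM -[leRHS]mulr1; apply: ler_pM => //.
    by apply: le_trans (exp_half_le1 l.+1); exact: coord_nbhs0_le.
  apply: le_trans (exp_half_le1 l.+1).
  by apply: coord_nbhs0_le => //; exact: leq_trans ml.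
- by move=> l j ml jm; apply: coord_nbhs0_le => //; exact: leq_trans ml.
move=> i j im jm; rewrite -wt//.
have [h hE] := coord_coef_ex m i j.
transitivity (h (pure2 t w)); last by rewrite hE mulrC.
rewrite -psitw !linear_sum; apply: eq_bigr => l _.
by rewrite psiE hE seq_coefE mulrA.
Qed.

Lemma phi_not_open (phi : {linear tensor3 E E E -> tensor2 (tensor2 E E) E}) :
  is_phi phi -> ~ open_map phi.
Proof.
move=> phiE phio.
have [psi psiE] := tensor3_lift (@pure12_trilinear R E E E).
have [theta thetaE] := tensor21_lift (@pure12_trilinear R E E E).
apply: (theta_not_continuous thetaE); apply/continuousP => G Go.
have thetaphi : theta \o phi =1 psi.
  by apply: (tensor3_ext (f := theta \o phi)) => a b c; rewrite /= phiE thetaE psiE.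
have [g phiK gK] := phi_bijective phiE.
(* Preimages under [theta] become images under [phi] of sets that are open by continuity of
   [psi]. *)
suff -> : theta @^-1` G = phi @` (psi @^-1` G).
  by apply: phio; have /continuousP := psi_continuous psiE; exact.
apply/seteqP; split=> [t /= Gt|_ [t /= Gt <-]].
  by exists (g t); rewrite /= ?gK// -thetaphi /= gK.
by rewrite -[theta _]/((theta \o phi) t) thetaphi.
Qed.

End Sequences.

(** The existence clauses keep the claims about all such maps from being vacuous; bijectivity
    records that the maps are isomorphisms of vector spaces. *)
Theorem theorem1 (R : realType) :
  let E : topologicalLmodType R := real_seq R in
  [/\ (exists theta : {linear tensor2 (tensor2 E E) E -> tensor2 E (tensor2 E E)},
         is_theta theta /\ bijective theta) /\
      (forall theta : {linear tensor2 (tensor2 E E) E -> tensor2 E (tensor2 E E)},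
         is_theta theta -> ~ continuous theta /\ ~ tvs_isomorphism theta),
      (exists phi : {linear tensor3 E E E -> tensor2 (tensor2 E E) E},
         is_phi phi /\ bijective phi) /\
      (forall phi : {linear tensor3 E E E -> tensor2 (tensor2 E E) E},
         is_phi phi -> continuous phi /\ ~ open_map phi)
    & (exists psi : {linear tensor3 E E E -> tensor2 E (tensor2 E E)},
         is_psi psi /\ bijective psi) /\
      (forall psi : {linear tensor3 E E E -> tensor2 E (tensor2 E E)},
         is_psi psi -> continuous psi /\ ~ open_map psi)].
Proof.
move=> E; split; split.
- have [theta thetaE] := tensor21_lift (@pure12_trilinear R E E E).
  by exists theta; split=> //; exact: theta_bijective.
- move=> theta /theta_not_continuous nc; split=> // -[g _ [thetac _]].
  exact: nc.
- have [phi phiE] := tensor3_lift (@pure21_trilinear R E E E).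
  by exists phi; split=> //; exact: phi_bijective.
- by move=> phi phiE; split; [exact: phi_continuous|exact: phi_not_open].
- have [psi psiE] := tensor3_lift (@pure12_trilinear R E E E).
  by exists psi; split=> //; exact: psi_bijective.
- by move=> psi psiE; split; [exact: psi_continuous|exact: psi_not_open].
Qed.
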